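(* Let $G$ be a cograph with cotree $T_G$ whose $\otimes$-nodes are $\{w_1,\ldots,w_j\}$, and assume each $w_i$ has $t_i$ children in $T_G$. Let $n_{-}(G)$ be the number of negative eigenvalues of $G$, counted with multiplicity. Then $$ n_{-}(G) = \sum_{i=1}^{j} (t_i - 1). $$
   Context: All graphs are finite, simple and undirected; the eigenvalues of a graph are those of its adjacency matrix. Cographs are the smallest class of graphs containing $K_1$ and closed under disjoint union $\cup$ and join $\otimes$. The cotree $T_G$ of a cograph $G$ is the unique rooted tree whose leaves are the vertices of $G$, whose interior nodes each have at least two children and are labelled $\cup$ or $\otimes$ so that the labels alternate along every root-to-leaf path, and such that two distinct vertices are adjacent in $G$ if and only if their least common ancestor is labelled $\otimes$; the cotree of a one-vertex graph is a single leaf. The number $t_i$ counts all children of $w_i$, both interior nodes and leaves. An empty sum is $0$. *)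

(* Defs.v *)
(* MathComp world. *)
From HB Require Import structures.
From mathcomp Require Import all_boot all_order all_algebra.
From mathcomp Require Import polyrcf.

Set Implicit Arguments.
Unset Strict Implicit.
Unset Printing Implicit Defensive.

Import Order.TTheory GRing.Theory Num.Theory.

Record sgraph := SGraph {
  vertex :> finType;
  adj : rel vertex;
  adj_sym : symmetric adj;
  adj_irr : irreflexive adj
}.

Definition giso (G H : sgraph) : Prop :=
  exists2 f : G -> H, bijective f & forall x y, adj (f x) (f y) = adj x y.

Section SumGraph.
Variables (b : bool) (G H : sgraph).

(* [b] tells whether vertices of different summands are adjacent. *)
Definition sum_adj (x y : (G + H)%type) : bool :=
  match x, y with
  | inl u, inl v => adj u v
  | inr u, inr v => adj u v
  | _, _ => b
  end.

Lemma sum_adj_sym : symmetric sum_adj.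
Proof. by case=> x [] y //=; apply: adj_sym. Qed.

Lemma sum_adj_irr : irreflexive sum_adj.
Proof. by case=> x /=; apply: adj_irr. Qed.

Definition gsum : sgraph := SGraph sum_adj_sym sum_adj_irr.
End SumGraph.

Definition gunion : sgraph -> sgraph -> sgraph := gsum false.
Definition gjoin : sgraph -> sgraph -> sgraph := gsum true.

Definition K1 : sgraph :=
  @SGraph unit (fun _ _ => false) (fun _ _ => erefl) (fun _ => erefl).

(* A class of graphs is understood to be closed under isomorphism. *)
Inductive cograph : sgraph -> Prop :=
| cograph_K1 : cograph K1
| cograph_union G H : cograph G -> cograph H -> cograph (gunion G H)
| cograph_join G H : cograph G -> cograph H -> cograph (gjoin G H)
| cograph_iso G H : giso G H -> cograph G -> cograph H.

Variant label := Union | Join.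

Definition label_is_join (l : label) : bool := if l is Join then true else false.

Lemma label_is_joinK :
  cancel label_is_join (fun b : bool => if b then Join else Union).
Proof. by case. Qed.

HB.instance Definition _ := Equality.copy label (can_type label_is_joinK).

(* The order of the children of a node is an artefact of the representation:
   nothing below depends on it. *)
Inductive tree (V : Type) : Type :=
| Leaf of V
| Node of label & seq (tree V).

Arguments Leaf {V}.
Arguments Node {V}.

Section TreeEqType.
Variable V : Type.

Fixpoint tree_encode (t : tree V) : GenTree.tree V :=
  match t with
  | Leaf v => GenTree.Leaf v
  | Node l ts => GenTree.Node (label_is_join l) (map tree_encode ts)
  end.

Fixpoint tree_decode (t : GenTree.tree V) : tree V :=
  match t with
  | GenTree.Leaf v => Leaf v
  | GenTree.Node n ts =>
      Node (if n is 0 then Union else Join) (map tree_decode ts)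
  end.

Lemma tree_encodeK : cancel tree_encode tree_decode.
Proof.
rewrite /cancel; fix IH 1 => -[v|l ts] /=; first by [].
congr Node; first by case: l.
by elim: ts => //= t ts ->; rewrite IH.
Qed.
End TreeEqType.

HB.instance Definition _ (V : eqType) :=
  Equality.copy (tree V) (can_type (@tree_encodeK V)).

Section Trees.
Variable V : eqType.
Implicit Types t w : tree V.

Definition children t : seq (tree V) := if t is Node _ ts then ts else [::].

Definition node_label t : option label :=
  if t is Node l _ then Some l else None.

Definition is_interior t : bool := node_label t != None.

Definition is_join t : bool := node_label t == Some Join.

(* A node of [t] is identified with the subtree of [t] rooted at it. Distinct
   nodes have distinct subtrees as soon as the leaves of [t] are pairwise
   distinct and every interior node has a child. *)
Fixpoint nodes t : seq (tree V) :=
  t :: match t with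
       | Leaf _ => [::]
       | Node _ ts => flatten (map nodes ts)
       end.

Fixpoint leaves t : seq V :=
  match t with
  | Leaf v => [:: v]
  | Node _ ts => flatten (map leaves ts)
  end.

(* Two consecutive interior nodes never carry the same label, i.e. the labels
   alternate along every root-to-leaf path. *)
Definition labels_alternate t : Prop :=
  forall w c, w \in nodes t -> c \in children w -> is_interior c ->
  node_label c != node_label w.

Definition common_ancestor t (u v : V) w : Prop :=
  [/\ w \in nodes t, u \in leaves w & v \in leaves w].

(* [w] is the least common ancestor: it lies below every common ancestor. *)
Definition is_lca t (u v : V) w : Prop :=
  common_ancestor t u v w /\
  forall w', common_ancestor t u v w' -> w \in nodes w'.

End Trees.

Record is_cotree (G : sgraph) (t : tree G) : Prop := IsCotree {
  cotree_leaves_uniq : uniq (leaves t);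
  cotree_leaves_all : forall v : G, v \in leaves t;
  cotree_children : forall w, w \in nodes t -> is_interior w ->
                    2 <= size (children w);
  cotree_alternate : labels_alternate t;
  cotree_adj : forall u v : G, u != v ->
    (adj u v <-> exists2 w, is_lca t u v w & is_join w)
}.

Local Open Scope ring_scope.

Definition adjacency (R : nzRingType) (G : sgraph) : 'M[R]_#|G| :=
  \matrix_(i, j) (adj (enum_val i) (enum_val j))%:R.

(* [rootsR p] lists the distinct roots of [p], and [mup x p] is the
   multiplicity of [x] as a root of [p]. *)
Definition num_neg_eigenvalues (R : rcfType) (n : nat) (A : 'M[R]_n) : nat :=
  (\sum_(x <- rootsR (char_poly A) | (x < 0)%R) mup x (char_poly A))%N.

(* Main.v *)
Require Import Defs.
From mathcomp Require Import all_boot all_order all_algebra.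
From mathcomp Require Import polyrcf.
From mathcomp Require Import spectral complex ring lra zify.

(** By Sylvester's law of inertia, the number of negative eigenvalues of a real
    symmetric matrix is the number of negative coefficients in any writing of
    its quadratic form as a combination of squares of independent linear forms
    ([num_neg_eigenvalues_congruence]). It thus suffices to diagonalise the
    adjacency form of the graph by congruence, which is done from the leaves of
    the cotree upwards.

    The vertices below a node of the cotree all have the same neighbours
    outside: the rest of the graph sees a vector [x] on them only through the
    sum [s] of its entries. The induction therefore writes the adjacency form
    on these vertices as [a s^2 + (squares of other forms)], with [s] and the
    other forms independent ([reduces_to]): the whole subtree behaves like a
    single vertex of weight [a]. For a leaf [a = 0]. Merging two such
    sibling blocks with weights [a1], [a2] and sums [s1], [s2] leaves the binary form
    [a1 s1^2 + a2 s2^2 + 2 b s1 s2] to be diagonalised, where [b = 1] under a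
    join node and [b = 0] under a union node, and [s1 + s2] must be one of the
    two new linear forms. The coefficient of the other square is the value at
    [(1, -1)], that is [a1 + a2 - 2 b].

    What makes the count work is that the weights stay in [0 <= a < 1]
    ([merge_pivot]): then [a1 + a2 - 2] is negative, while [a1 + a2] is not. So
    each merge under a join node creates exactly one negative square and a
    merge under a union node creates none. A node with [t] children takes
    [t - 1] merges. *)

Set Implicit Arguments.
Unset Strict Implicit.
Unset Printing Implicit Defensive.
Import Order.TTheory GRing.Theory Num.Theory.
Local Open Scope ring_scope.
Local Open Scope sesquilinear_scope.

(** * Inertia of a diagonalised Hermitian form *)

Definition neg_count (R : numDomainType) n (d : 'rV[R]_n) : nat :=
  #|[pred i | d 0 i < 0]|.

Lemma wide_kernel (F : fieldType) n m (M : 'M[F]_(n, m)) : (m < n)%N ->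
  exists2 x : 'rV_n, x != 0 & x *m M = 0.
Proof.
move=> lt_mn; have kerN0 : kermx M != 0.
  rewrite kermx_eq0 /row_free; apply: contraTneq lt_mn => rkM.
  by rewrite -leqNgt -rkM rank_leq_col.
exists (nz_row (kermx M)); first by rewrite nz_row_eq0.
by apply/sub_kermxP; apply: nz_row_sub.
Qed.

Lemma hermitian_form_diag (C : numClosedFieldType) n (P : 'M[C]_n)
    (d x : 'rV[C]_n) :
  (x *m (P *m diag_mx d *m P^t*) *m x^t*) 0 0 =
  \sum_i d 0 i * `|(x *m P) 0 i| ^+ 2.
Proof.
have -> : x *m (P *m diag_mx d *m P^t*) *m x^t* =
          (x *m P) *m diag_mx d *m (x *m P)^t*.
  by rewrite trmx_mul map_mxM !mulmxA.
rewrite mul_mx_diag mxE; apply: eq_bigr => i _.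
by rewrite !mxE normCK mulrCA mulrA.
Qed.

(** One half of Sylvester's law. If the first diagonal had more negative
    entries than the second, then fewer than [n] linear equations would define
    the space of the [x] such that [x *m P] vanishes wherever [d] is not
    negative and [x *m Q] vanishes wherever [e] is negative; on a nonzero vector
    of this space the common form would be both negative and nonnegative. *)
Lemma inertia_le (C : numClosedFieldType) n (P Q : 'M[C]_n) (d e : 'rV[C]_n) :
  P \in unitmx -> (forall i, e 0 i \is Num.real) ->
  P *m diag_mx d *m P^t* = Q *m diag_mx e *m Q^t* ->
  (neg_count d <= neg_count e)%N.
Proof.
move=> Punit e_real eqPQ; rewrite leqNgt; apply/negP => lt_ed.
pose nonneg_d := [pred i | ~~ (d 0 i < 0)]; pose neg_e := [pred i | e 0 i < 0].
pose M := row_mx (colsub (@enum_val _ nonneg_d) P) (colsub (@enum_val _ neg_e) Q).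
have [|x xN0 xM0] := @wide_kernel _ _ _ M.
  by rewrite -[X in (_ < X)%N](card_ord n) -(cardC [pred i | d 0 i < 0]) addnC
             ltn_add2r.
have [xP0 xQ0] : x *m colsub (@enum_val _ nonneg_d) P = 0
              /\ x *m colsub (@enum_val _ neg_e) Q = 0.
  by apply/eq_row_mx; rewrite -mul_mx_row row_mx0.
have {}xP0 i : ~~ (d 0 i < 0) -> (x *m P) 0 i = 0.
  move=> di; have diA : i \in nonneg_d by [].
  have /rowP/(_ (enum_rank_in diA i)) := xP0; rewrite !mxE => sum0.
  by rewrite -[RHS]sum0; apply: eq_bigr => k _; rewrite mxE enum_rankK_in.
have {}xQ0 i : e 0 i < 0 -> (x *m Q) 0 i = 0.
  move=> ei; have eiA : i \in neg_e by [].
  have /rowP/(_ (enum_rank_in eiA i)) := xQ0; rewrite !mxE => sum0.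
  by rewrite -[RHS]sum0; apply: eq_bigr => k _; rewrite mxE enum_rankK_in.
have ge0 : 0 <= \sum_i e 0 i * `|(x *m Q) 0 i| ^+ 2.
  apply: sumr_ge0 => i _; have [ei|ei] := real_ltP (e_real i) (real0 C).
    by rewrite xQ0 // normr0 expr0n mulr0.
  by rewrite mulr_ge0 // exprn_ge0.
have /rV0Pn[i xPi] : x *m P != 0.
  by apply: contraNneq xN0 => xP; rewrite -(mulmxK Punit x) xP mul0mx.
move: ge0; rewrite -hermitian_form_diag -eqPQ hermitian_form_diag.
apply/negP; rewrite lt_geF // (bigD1 i) //=.
have di : d 0 i < 0 by apply: contraNT xPi => /xP0->.
rewrite ltr_wnDr //; last by rewrite pmulr_llt0 // exprn_gt0 // normr_gt0.
apply: sumr_le0 => k _; have [dk|dk] := boolP (d 0 k < 0).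
  by rewrite mulr_le0_ge0 ?exprn_ge0 // ltW.
by rewrite xP0 // normr0 expr0n mulr0.
Qed.

(** * Negative eigenvalues of a real symmetric matrix *)

Lemma num_neg_eigenvalues_split (R : rcfType) n (A : 'M[R]_n) (r : 'rV[R]_n) :
  char_poly A = \prod_i ('X - (r 0 i)%:P) -> num_neg_eigenvalues A = neg_count r.
Proof.
move=> chA; rewrite /num_neg_eigenvalues.
have chN0 : char_poly A != 0 by rewrite monic_neq0 ?char_poly_monic.
have mupE x : mup x (char_poly A) = (\sum_i (r ord0 i == x))%N.
  rewrite chA -(big_map (r 0) predT (fun y => 'X - y%:P)) mu_prod_XsubC.
  by rewrite -sum1_count big_map big_mkcond.
under eq_bigr => x _ do rewrite mupE.
rewrite exchange_big /= /neg_count -sum1_card [RHS]big_mkcond /=.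
apply: eq_bigr => i _; rewrite inE.
have ri : r 0 i \in rootsR (char_poly A).
  rewrite -[_ \in _](roots_onP (roots_on_rootsR chN0)) ?in_itv //.
  rewrite chA -(big_map (r 0) predT (fun y => 'X - y%:P)) root_prod_XsubC.
  by apply/mapP; exists i; rewrite ?mem_index_enum.
rewrite big_mkcond (bigD1_seq (r 0 i)) ?uniq_roots //= eqxx big1 ?addn0.
  by case: (_ < 0).
by move=> x /negPf; rewrite eq_sym => ->; case: ifP.
Qed.

Lemma char_poly_conj (K : comUnitRingType) n (P A : 'M[K]_n) :
  P \in unitmx -> char_poly (invmx P *m A *m P) = char_poly A.
Proof.
move=> Punit; pose PX := map_mx polyC P; pose VX := map_mx polyC (invmx P).
have VPX : VX *m PX = 1%:M by rewrite -map_mxM mulVmx // map_mx1.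
rewrite /char_poly.
have -> : char_poly_mx (invmx P *m A *m P) = VX *m char_poly_mx A *m PX.
  by rewrite /char_poly_mx mulmxBr mulmxBl mul_mx_scalar -scalemxAl VPX
             scalemx1 !map_mxM.
by rewrite !det_mulmx mulrAC -det_mulmx VPX det1 mul1r.
Qed.

(** The spectral theorem is applied over the complex numbers, where the
    characteristic polynomial splits; since a real symmetric matrix is
    Hermitian its eigenvalues are real, so this polynomial already splits over
    [R]. *)
Lemma real_spectral (R : rcfType) n (A : 'M[R]_n) : A^T = A ->
  exists (U : 'M[R[i]]_n) (r : 'rV[R]_n),
    [/\ U \in unitmx,
        map_mx (real_complex R) A = U *m diag_mx (map_mx (real_complex R) r) *m U^t*
      & char_poly A = \prod_i ('X - (r 0 i)%:P)].
Proof.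
move=> Asym; set AC := map_mx _ A.
have AC_real : AC \is a mxOver Num.real.
  by apply/mxOverP => i j; rewrite mxE complex_real.
have AC_herm : AC \is hermsymmx.
  apply: realsym_hermsym AC_real; rewrite qualifE /= expr0 scale1r.
  by rewrite map_mx_id // map_trmx Asym.
have /orthomx_spectralP ACE := hermitian_normalmx AC_herm.
have /mxOverP d_real := hermitian_spectral_diag_real AC_herm.
have Uunit := spectral_unitarymx AC.
set U := spectralmx AC in ACE Uunit; set d := spectral_diag AC in ACE d_real.
pose r := \row_i complex.Re (d 0 i).
have dE : map_mx (real_complex R) r = d.
  by apply/rowP => i; rewrite !mxE RRe_real.
exists (invmx U), r; split.
- by rewrite unitmx_inv unitarymx_unit.
- by rewrite dE {1}ACE invmx_unitary // trmxCK.
apply: (map_inj_poly (f := real_complex R)) => //; first exact: complexI.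
rewrite map_char_poly -/AC ACE char_poly_conj ?unitarymx_unit //.
rewrite char_poly_trig ?diag_mx_is_trig // rmorph_prod /=.
apply: eq_bigr => i _.
by rewrite rmorphB /= map_polyX map_polyC -dE !mxE eqxx mulr1n.
Qed.

(** The spectral decomposition and the given congruence are two
    diagonalisations of the same Hermitian form, so their diagonals have equally
    many negative entries; those of the first are the eigenvalues. *)
Theorem num_neg_eigenvalues_congruence (R : rcfType) n (P A : 'M[R]_n) (d : 'rV[R]_n) :
  P \in unitmx -> A = P *m diag_mx d *m P^T ->
  num_neg_eigenvalues A = neg_count d.
Proof.
move=> Punit AE.
have Asym : A^T = A by rewrite AE !trmx_mul trmxK tr_diag_mx mulmxA.
have [U [r [Uunit ACE chA]]] := real_spectral Asym.
rewrite (num_neg_eigenvalues_split chA).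
have real_row (v : 'rV[R]_n) i : map_mx (real_complex R) v 0 i \is Num.real.
  by rewrite mxE complex_real.
have neg_count_C (v : 'rV[R]_n) : neg_count (map_mx (real_complex R) v) = neg_count v.
  by apply: eq_card => i; rewrite !inE mxE ltcR.
pose PC := map_mx (real_complex R) P.
have PCE : map_mx (real_complex R) A =
    PC *m diag_mx (map_mx (real_complex R) d) *m PC^t*.
  rewrite AE !map_mxM map_diag_mx map_trmx; congr (_ *m _).
  by apply/matrixP => i j; rewrite !mxE conj_Creal // complex_real.
rewrite -(neg_count_C r) -(neg_count_C d); apply/eqP; rewrite eqn_leq.
have PCunit : PC \in unitmx by rewrite map_unitmx.
have eqUP := etrans (esym ACE) PCE.
by rewrite (inertia_le Uunit (real_row d) eqUP)
           (inertia_le PCunit (real_row r) (esym eqUP)).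
Qed.

(** * Reduction of a block of vertices to one weighted vertex *)

(** The form is stated entrywise: [s] pairs each coefficient with the vector of
    coefficients of its linear form, and the indicator of [L] is the linear form
    that sums the entries over [L]. The last field says that these linear forms
    are independent on the vectors supported by [L]. *)
Record reduces_to (R : realFieldType) (G : sgraph) (L : seq G) (a : R)
    (s : seq (R * {ffun G -> R})) : Prop := ReducesTo {
  reduces_size : (size s).+1 = size L;
  reduces_itv : 0 <= a < 1;
  reduces_form : forall u v : G,
    [&& u \in L, v \in L & adj u v]%:R =
      a * ((u \in L)%:R * (v \in L)%:R) + \sum_(p <- s) p.1 * (p.2 u * p.2 v);
  reduces_free : forall x : G -> R,
    \sum_u x u * (u \in L)%:R = 0 ->
    (forall p, p \in s -> \sum_u x u * p.2 u = 0) ->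
    forall u, u \in L -> x u = 0
}.

Definition neg_terms (R : realFieldType) (V : finType)
  (s : seq (R * {ffun V -> R})) : nat := count (fun p => p.1 < 0) s.

Section Merge.
Variables (R : realFieldType) (G : sgraph).
Implicit Types (L : seq G) (a : R).

Lemma reduces_leaf (v : G) : reduces_to (R := R) [:: v] 0 [::].
Proof.
split=> [//|| u w | x + _ u].
- by rewrite lexx ltr01.
- rewrite big_nil mul0r addr0 !inE.
  by case: eqP => //= ->; case: eqP => //= ->; rewrite adj_irr.
- rewrite (bigD1 v) //= big1 => [|w /negPf wv]; last by rewrite inE wv mulr0.
  by rewrite addr0 !inE eqxx mulr1 => xv /eqP->.
Qed.

(** Diagonalisation of the binary form left by a merge, in the coordinates
    [s1 + s2] and [s1 - e (s1 + s2)]; the first basis vector [(e, 1 - e)] is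
    chosen orthogonal to [(1, -1)]. *)
Lemma merge_pivot (a1 a2 : R) (b : bool) : 0 <= a1 < 1 -> 0 <= a2 < 1 ->
  exists e a d : R, [/\ 0 <= a < 1, (d < 0) = b &
    forall s1 s2 t1 t2 : R,
      a1 * (s1 * t1) + a2 * (s2 * t2) + b%:R * (s1 * t2 + s2 * t1) =
      a * ((s1 + s2) * (t1 + t2)) +
      d * ((s1 - e * (s1 + s2)) * (t1 - e * (t1 + t2)))].
Proof.
move=> /andP[a1_ge0 a1_lt1] /andP[a2_ge0 a2_lt1].
pose d := a1 + a2 - 2 * b%:R.
(* Two blocks of weight 0 that are not joined: the binary form vanishes. *)
have [d0|dN0] := eqVneq d 0.
  have [b0 a10 a20] : [/\ b = false, a1 = 0 & a2 = 0].
    by move: d0; rewrite /d; case: (b) => /= d0; split=> //; lra.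
  exists 0, 0, 0; rewrite b0 a10 a20 ltxx lexx ltr01; split=> // u1 u2 v1 v2 /=; ring.
have dP : (d < 0) = b.
  rewrite /d; case: (b); rewrite ?mulr1 ?mulr0 ?subr0; first by apply/idP; lra.
  by apply/negbTE; rewrite -leNgt addr_ge0.
exists ((a2 - b%:R) / d), ((a1 * a2 - b%:R) / d), d; split=> //; last first.
  move=> u1 u2 v1 v2; move: dN0; rewrite /d.
  by case: (b); rewrite /= ?mulr1 ?mulr0 ?subr0 => dN0; field.
(* With these products of the bounds on [a1] and [a2], the bounds on the weight
   become linear. *)
have mul_itv : [/\ 0 <= a1 * a2, a1 * a2 < 1, a1 * a2 <= a1, a1 * a2 <= a2
                 & a1 + a2 - 1 < a1 * a2].
  by split; nra.
case: mul_itv => [mul_ge0 mul_lt1 mul_le1 mul_le2 mul_gt].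
move: dP dN0; rewrite /d; case: (b); rewrite /= ?mulr1 ?mulr0 ?subr0 => dP dN0.
  by rewrite ler_ndivlMr // ltr_ndivrMr //; apply/andP; split; lra.
have d_gt0 : 0 < a1 + a2 by rewrite lt_def dN0 addr_ge0.
by rewrite ler_pdivlMr // ltr_pdivrMr //; apply/andP; split; lra.
Qed.

(** Under the cross condition the two blocks interact only through their two
    sums. The pivot trades these for the sum over [L1 ++ L2] and one more form
    [h], an invertible change that keeps the forms independent. *)
Lemma reduces_cat L1 L2 (b : bool) a1 a2 (s1 s2 : seq (R * {ffun G -> R})) :
  uniq (L1 ++ L2) ->
  (forall u v, u \in L1 -> v \in L2 -> adj u v = b) ->
  reduces_to L1 a1 s1 -> reduces_to L2 a2 s2 ->
  exists a s, reduces_to (L1 ++ L2) a s /\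
              neg_terms s = (neg_terms s1 + neg_terms s2 + b)%N.
Proof.
move=> uL cross [sz1 a1P form1 free1] [sz2 a2P form2 free2].
have [e [a [d [aP dP pivot]]]] := merge_pivot b a1P a2P.
have disj w : w \in L2 -> (w \in L1) = false.
  by move: uL; rewrite cat_uniq => /and3P[_ /hasPn dis _] /dis/negPf.
have indD u : (u \in L1 ++ L2)%:R = (u \in L1)%:R + (u \in L2)%:R :> R.
  rewrite mem_cat; have := disj u.
  by case: (_ \in L2) => [->|_]; rewrite // ?add0r // orbF addr0.
pose h : {ffun G -> R} := [ffun u => (u \in L1)%:R - e * (u \in L1 ++ L2)%:R].
exists a, ((d, h) :: s1 ++ s2); split; last first.
  by rewrite /neg_terms /= count_cat dP addnC.
split=> //= [||x xL xs].
- by rewrite !size_cat -sz1 -sz2 addnS.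
- move=> u v; rewrite big_cons big_cat /= !ffunE.
  have -> : [&& u \in L1 ++ L2, v \in L1 ++ L2 & adj u v]%:R =
      [&& u \in L1, v \in L1 & adj u v]%:R +
      [&& u \in L2, v \in L2 & adj u v]%:R +
      b%:R * ((u \in L1)%:R * (v \in L2)%:R + (u \in L2)%:R * (v \in L1)%:R) :> R.
    rewrite !mem_cat; move: (cross u v) (cross v u) (disj u) (disj v).
    rewrite (adj_sym v u).
    case: (u \in L1) (u \in L2) (v \in L1) (v \in L2) => [] [] [] [] c1 c2 du dv;
      (try by have := du isT); (try by have := dv isT);
      (try rewrite (c1 isT isT)); (try rewrite (c2 isT isT)) => /=; ring.
  have := pivot (u \in L1)%:R (u \in L2)%:R (v \in L1)%:R (v \in L2)%:R.
  rewrite form1 form2 !indD; lra.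
- have xh : \sum_w x w * (w \in L1)%:R = 0.
    have /xs : (d, h) \in (d, h) :: s1 ++ s2 by rewrite mem_head.
    under eq_bigr => w _ do rewrite ffunE mulrBr mulrCA.
    by rewrite sumrB -mulr_sumr xL mulr0 subr0.
  have xh2 : \sum_w x w * (w \in L2)%:R = 0.
    rewrite -[RHS]xL -[LHS]add0r -{1}xh -big_split /=.
    by apply: eq_bigr => w _; rewrite indD mulrDr.
  move=> u; rewrite mem_cat => /orP[].
    by apply: free1 => // p ps; apply: xs; rewrite inE mem_cat ps orbT.
  by apply: free2 => // p ps; apply: xs; rewrite inE mem_cat ps !orbT.
Qed.
End Merge.

(** When [L] exhausts the vertices, the linear forms of the reduction are the
    columns of a congruence that diagonalises the adjacency matrix; the weight
    [a], being nonnegative, contributes no negative term. *)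
Lemma num_neg_reduces (R : rcfType) (G : sgraph) (L : seq G) a
    (s : seq (R * {ffun G -> R})) :
  uniq L -> (forall v, v \in L) -> reduces_to L a s ->
  num_neg_eigenvalues (adjacency R G) = neg_terms s.
Proof.
move=> uL allL [sz /andP[a_ge0 _] form free].
pose ind : {ffun G -> R} := [ffun u => (u \in L)%:R].
pose t := (a, ind) :: s.
have szt : size t = #|G|.
  by rewrite /= sz -(card_uniqP uL); apply: eq_card => v; rewrite allL.
pose P := \matrix_(i < #|G|, k < #|G|) (nth (0, ind) t k).2 (enum_val i).
pose d := \row_(k < #|G|) (nth (0, ind) t k).1.
have sum_t T (x : T) (op : Monoid.law x) (F : _ -> T) :
    \big[op/x]_(p <- t) F p = \big[op/x]_(k < #|G|) F (nth (0, ind) t k).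
  by rewrite (big_nth (0, ind)) szt big_mkord.
rewrite (num_neg_eigenvalues_congruence (P := P) (d := d)); last first.
- apply/matrixP => i j; rewrite mul_mx_diag !mxE.
  have := form (enum_val i) (enum_val j); rewrite !allL /= => ->.
  transitivity (\sum_(p <- t) p.1 * (p.2 (enum_val i) * p.2 (enum_val j))).
    by rewrite big_cons /= !ffunE !allL.
  by rewrite sum_t; apply: eq_bigr => k _; rewrite !mxE mulrCA mulrA.
- rewrite -row_free_unit; apply: inj_row_free => x xP.
  pose y u := x 0 (enum_rank u).
  have sum_y p : p \in t -> \sum_u y u * p.2 u = 0.
    move=> /(nthP (0, ind))[k]; rewrite szt => ltk <-.
    have /rowP/(_ (Ordinal ltk)) := xP; rewrite !mxE => sum0.
    rewrite -[RHS]sum0 (reindex (@enum_val _ (mem G))) /=.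
      by apply: eq_bigr => i _; rewrite mxE /y enum_valK.
    exact/onW_bij/enum_val_bij.
  apply/rowP => i; rewrite mxE -(enum_valK i).
  apply: (free y) => // [|p ps]; last by apply: sum_y; rewrite inE ps orbT.
  rewrite -[RHS](sum_y (a, ind)) ?mem_head //=.
  by apply: eq_bigr => u _; rewrite ffunE.
transitivity (neg_terms t); last by rewrite /neg_terms /= ltNge a_ge0.
rewrite /neg_count /neg_terms -sum1_card -sum1_count big_mkcond [RHS]big_mkcond.
by rewrite sum_t; apply: eq_bigr => k _; rewrite !inE mxE.
Qed.

(** * Least common ancestors in a tree with distinct leaves *)

Lemma tree_mem_ind (V : eqType) (P : tree V -> Prop) :
  (forall v, P (Leaf v)) ->
  (forall l ts, (forall t, t \in ts -> P t) -> P (Node l ts)) ->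
  forall t, P t.
Proof.
(* [IH] is cleared where closing the goal with it would break the guard. *)
move=> Pleaf Pnode; fix IH 1 => -[v|l ts]; first exact: Pleaf.
apply: Pnode; elim: ts => [|t ts IHts] c; first by clear IH; rewrite in_nil.
by rewrite inE => /predU1P[->|]; [apply: IH | apply: IHts].
Qed.

Lemma uniq_flatten_map (T S : eqType) (f : T -> seq S) (s : seq T) x :
  uniq (flatten (map f s)) -> x \in s -> uniq (f x).
Proof.
move=> us xs; move: us; case/splitPr: xs => s1 s2.
by rewrite map_cat flatten_cat /= !cat_uniq => /and3P[_ _ /and3P[]].
Qed.

Lemma uniq_flatten_map_inj (T S : eqType) (f : T -> seq S) (s : seq T) x y z :
  uniq (flatten (map f s)) -> x \in s -> y \in s -> z \in f x -> z \in f y ->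
  x = y.
Proof.
elim: s => //= d s IH; rewrite cat_uniq => /and3P[_ /hasPn disj /IH{}IH].
have disj_d w : w \in s -> z \in f d -> z \in f w -> False.
  move=> ws zd zw; suff /disj/negP : z \in flatten (map f s) by [].
  by apply/flatten_mapP; exists w.
rewrite !inE => /predU1P[->|xs] /predU1P[->|ys] // zx zy; last exact: IH.
- by case: (disj_d y).
- by case: (disj_d x).
Qed.

Section CotreeStructure.
Variable V : eqType.
Implicit Types (t c w : tree V) (ts : seq (tree V)) (u v : V).

Lemma nodes_root t : t \in nodes t.
Proof. by case: t => [v|l ts]; rewrite mem_head. Qed.

Lemma mem_nodes_child l ts c w :
  c \in ts -> w \in nodes c -> w \in nodes (Node l ts).
Proof. by move=> cts wc; rewrite inE; apply/orP; right; apply/flatten_mapP; exists c. Qed.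

Lemma mem_leaves_child l ts c u :
  c \in ts -> u \in leaves c -> u \in leaves (Node l ts).
Proof. by move=> cts uc; apply/flatten_mapP; exists c. Qed.

Lemma leaves_sub_nodes t w u : w \in nodes t -> u \in leaves w -> u \in leaves t.
Proof.
elim/tree_mem_ind: t => [v|l ts IH]; first by rewrite inE => /eqP->.
rewrite inE => /predU1P[-> //|/flatten_mapP[c cts wc] uw].
exact: (mem_leaves_child l cts (IH c cts wc uw)).
Qed.

Section Node.
Variables (l : label) (ts : seq (tree V)) (c : tree V) (u v : V).
Hypotheses (uniq_ts : uniq (leaves (Node l ts))) (c_ts : c \in ts)
           (u_c : u \in leaves c).

(** As the leaves are distinct, [c] is the only child above [u]; hence a common
    ancestor other than the root lies below [c]. *)
Lemma common_ancestor_node w : common_ancestor (Node l ts) u v w ->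
  w = Node l ts \/ common_ancestor c u v w.
Proof.
case; rewrite inE => /predU1P[|/flatten_mapP[c' c'_ts w_c'] uw vw]; first by left.
right; split=> //; suff -> : c = c' by [].
exact: (uniq_flatten_map_inj uniq_ts c_ts c'_ts u_c (leaves_sub_nodes w_c' uw)).
Qed.

Lemma is_lca_child w : v \in leaves c ->
  is_lca (Node l ts) u v w <-> is_lca c u v w.
Proof.
move=> v_c; have anc_c : common_ancestor c u v c by split; rewrite // nodes_root.
have up w' : common_ancestor c u v w' -> common_ancestor (Node l ts) u v w'.
  by case=> w'c uw' vw'; split=> //; apply: mem_nodes_child w'c.
split=> [[[_ uw vw] least]|[anc least]].
  by split=> [|w' /up/least//]; split=> //; apply/least/up.
split=> [|w' /common_ancestor_node[->|/least//]]; first exact: up.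
by case: anc => wc _ _; apply: mem_nodes_child wc.
Qed.

Lemma is_lca_root w : v \in leaves (Node l ts) -> v \notin leaves c ->
  is_lca (Node l ts) u v w <-> w = Node l ts.
Proof.
move=> v_t v_nc; have root w' : common_ancestor (Node l ts) u v w' -> w' = Node l ts.
  case/common_ancestor_node=> // -[w'c _ vw'].
  by rewrite (leaves_sub_nodes w'c vw') in v_nc.
split=> [[/root] //|->]; split=> [|w' /root->]; last exact: nodes_root.
by split=> //; [apply: nodes_root | apply: mem_leaves_child u_c].
Qed.

End Node.
End CotreeStructure.

(** * From the cotree to the reduction *)

Definition join_count (V : eqType) (t : tree V) : nat :=
  (\sum_(w <- nodes t | is_join w) (size (children w) - 1))%N.

Lemma join_count_node (V : eqType) l (ts : seq (tree V)) :
  join_count (Node l ts) =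
  ((label_is_join l) * (size ts - 1) + \sum_(c <- ts) join_count c)%N.
Proof.
rewrite /join_count /= big_cons big_flatten big_map.
by case: l; rewrite /is_join /= ?mul1n ?mul0n.
Qed.

(** A form of [is_cotree] for the subgraph on the leaves of [t], so that it
    passes to the children of a node. *)
Record represents (G : sgraph) (t : tree G) : Prop := Represents {
  represents_uniq : uniq (leaves t);
  represents_children : forall w, w \in nodes t -> is_interior w ->
    children w != [::];
  represents_adj : forall u v, u \in leaves t -> v \in leaves t -> u != v ->
    (adj u v <-> exists2 w, is_lca t u v w & is_join w)
}.

Lemma represents_child (G : sgraph) l (ts : seq (tree G)) c :
  represents (Node l ts) -> c \in ts -> represents c.
Proof.
case=> uL ch adjP c_ts; split.
- exact: uniq_flatten_map uL c_ts.
- by move=> w w_c; apply: ch; apply: mem_nodes_child w_c.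
move=> u v uc vc uv.
rewrite (adjP u v _ _ uv); try exact: mem_leaves_child c_ts _.
by split=> -[w lca jw]; exists w => //; apply/(is_lca_child uL c_ts uc w vc).
Qed.

Lemma represents_cross (G : sgraph) l (ts : seq (tree G)) c u v :
  represents (Node l ts) -> c \in ts -> u \in leaves c ->
  v \in leaves (Node l ts) -> v \notin leaves c -> adj u v = label_is_join l.
Proof.
case=> uL _ adjP c_ts uc vt v_nc.
have uv : u != v by apply: contraNneq v_nc => <-.
have ut := mem_leaves_child l c_ts uc.
have rootP w := is_lca_root uL c_ts uc w vt v_nc.
apply/idP/idP => [/(adjP u v ut vt uv)[w /rootP->]|jl]; first by case: (l).
apply/(adjP u v ut vt uv); exists (Node l ts); first exact/rootP.
by case: (l) jl.
Qed.

(** At an interior node the children are merged one after the other into the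
    block formed by the later ones; the last child starts the block and each
    merge contributes one negative term exactly when the node is a join. *)
Lemma represents_reduces (R : realFieldType) (G : sgraph) (t : tree G) :
  represents t -> exists a (s : seq (R * {ffun G -> R})),
    reduces_to (leaves t) a s /\ neg_terms s = join_count t.
Proof.
elim/tree_mem_ind: t => [v|l ts IH] rep.
  exists 0, [::]; split; first exact: reduces_leaf.
  by rewrite /join_count big_cons big_nil.
suff forest ts' : ts' != [::] -> {subset ts' <= ts} ->
    uniq (flatten (map (@leaves _) ts')) -> exists a (s : seq (R * {ffun G -> R})),
    reduces_to (flatten (map (@leaves _) ts')) a s /\
    neg_terms s = (label_is_join l * (size ts' - 1) +
                   \sum_(c <- ts') join_count c)%N.
  rewrite join_count_node; apply: forest => //.
    exact: (represents_children rep (nodes_root (Node l ts)) isT).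
  exact: represents_uniq rep.
elim: ts' => // c ts' IHts' _ sub_ts.
have c_ts : c \in ts by rewrite sub_ts ?mem_head.
have [a1 [s1 [red1 neg1]]] := IH c c_ts (represents_child rep c_ts).
have [-> _|ts'N0] := eqVneq ts' [::].
  by exists a1, s1; rewrite /= cats0 big_seq1 muln0 add0n.
rewrite /= => uL; have := uL; rewrite cat_uniq => /and3P[_ /hasPn disj uL'].
have sub' : {subset ts' <= ts} by move=> d dts'; rewrite sub_ts // inE dts' orbT.
have [a2 [s2 [red2 neg2]]] := IHts' ts'N0 sub' uL'.
have cross u v : u \in leaves c -> v \in flatten (map (@leaves _) ts') ->
    adj u v = label_is_join l.
  move=> uc vts'; apply: (represents_cross rep c_ts uc) (disj v vts').
  have /flatten_mapP[d dts' vd] := vts'.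
  exact: mem_leaves_child (sub' d dts') vd.
have [a [s [red neg]]] := reduces_cat uL cross red1 red2.
exists a, s; split=> //; rewrite neg neg1 neg2 big_cons /=.
by case: (ts') ts'N0 => // d ts'' _; rewrite /= !subn1 /=; lia.
Qed.

Local Close Scope sesquilinear_scope.
Local Close Scope ring_scope.

Theorem theorem4 (R : rcfType) (G : sgraph) (HG : cograph G)
    (T : tree G) (HT : is_cotree T) :
  num_neg_eigenvalues (adjacency R G) =
  \sum_(w <- nodes T | is_join w) (size (children w) - 1).
Proof.
case: HT => uL allL ch _ adjP.
have [|a [s [red neg]]] := @represents_reduces R G T.
  split=> // [w wT int_w|u v _ _ uv]; last exact: adjP.
  by have := ch w wT int_w; case: (children w).
by rewrite (num_neg_reduces uL allL red).
Qed.
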